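(* There exists a convex equilateral small $32$-gon whose perimeter exceeds that of $A_{32}$, where $A_{32}$ is the convex equilateral small $32$-gon defined in the context.
   Context: Polygons are in the Euclidean plane. The diameter of a polygon is the largest distance between any pair of its vertices. A polygon is small if its diameter equals $1$. It is equilateral if all its sides have the same length. Definition of $A_n$ for $n=2^s$, $s\ge 4$ (used here with $n=32$). For $t\in(0,\pi/n)$ let $u_j(t)=(\sin jt,\cos jt)$. Let $j_1<j_2<\cdots<j_{3n/8-1}$ be the elements, in increasing order, of $\{1,2,\ldots,n/2-1\}\setminus\{4k-2 : 1\le k\le n/8\}$. Put $p_0=(0,0)$ and $$p_i = p_{i-1}+(-1)^{i-1}u_{j_i}(t),\qquad 1\le i\le 3n/8-1,$$ and $$q_k = p_{3k-2}+(-1)^k u_{4k-2}(t),\qquad 1\le k\le n/8.$$ Let $\rho(x,y)=(-x,y)$. Let $t$ be the largest solution in $(0,\pi/n)$ of the equation $$\|p_{3n/8-2}-\rho(p_{3n/8-1})\| = 2\sin(t/2).$$ Equivalently, writing $x=\sin t - \frac{(2\cos t-1)(\sin 2t+\sin((n/2-2)t))}{2\cos 2t}$ for the abscissa of $p_{3n/8-2}$, this equation is $(2x+\sin((n/2-1)t))^2+\cos^2((n/2-1)t)=4\sin^2(t/2)$. With this value of $t$, $A_n$ is the polygon whose $n$ vertices are $(0,0)$, $(0,1)$, the points $p_1,\ldots,p_{3n/8-1}$, the points $q_1,\ldots,q_{n/8}$, and the images under $\rho$ of all the points $p_i$ ($i\ge 1$) and $q_k$; it is the convex hull of these points. It is a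 convex equilateral small $n$-gon with side length $2\sin(t/2)$, so its perimeter is $2n\sin(t/2)$; for $n=32$ this perimeter is $3.1402460942\ldots$ *)

(* Defs.v *)
From Stdlib Require Import Reals List Arith ClassicalEpsilon.
Import ListNotations.
Open Scope R_scope.

Definition point : Type := (R * R)%type.

Definition dist (z w : point) : R := dist_euc (fst z) (snd z) (fst w) (snd w).

(* Twice the signed area of the triangle a b c; it is positive exactly when c
   lies strictly to the left of the directed line from a to b. *)
Definition cross (a b c : point) : R :=
  (fst b - fst a) * (snd c - snd a) - (snd b - snd a) * (fst c - fst a).

(* A polygon is the list of its vertices in cyclic order; vertex indices are
   read modulo the length of the list. *)
Definition polygon : Type := list point.

Definition vertex (P : polygon) (i : nat) : point :=
  nth (i mod length P) P (0, 0).

Definition side (P : polygon) (i : nat) : R :=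
  dist (vertex P i) (vertex P (S i)).

Definition perimeter (P : polygon) : R :=
  fold_right Rplus 0 (map (side P) (seq 0 (length P))).

(* Convex polygons are listed counterclockwise.  The inequality is strict, so
   the vertices are pairwise distinct, no angle equals PI, and a convex polygon
   of length n is a genuine n-gon. *)
Definition convex (P : polygon) : Prop :=
  (3 <= length P)%nat /\
  forall i k : nat,
    (i < length P)%nat -> (k < length P)%nat ->
    k <> i -> k <> (S i mod length P)%nat ->
    0 < cross (vertex P i) (vertex P (S i)) (vertex P k).

Definition equilateral (P : polygon) : Prop :=
  forall i j : nat,
    (i < length P)%nat -> (j < length P)%nat -> side P i = side P j.

Definition is_diameter (P : polygon) (d : R) : Prop :=
  (exists z w : point, In z P /\ In w P /\ dist z w = d) /\
  (forall z w : point, In z P -> In w P -> dist z w <= d).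

Definition small (P : polygon) : Prop := is_diameter P 1.

(* The family A_n below is meaningful for n = 2 ^ s with s >= 4. *)

Definition u (t : R) (j : nat) : point :=
  (sin (INR j * t), cos (INR j * t)).

(* a + (-1)^e b *)
Definition add_signed (a : point) (e : nat) (b : point) : point :=
  (fst a + (-1) ^ e * fst b, snd a + (-1) ^ e * snd b).

Definition skipped (n : nat) : list nat :=
  map (fun k => (4 * k - 2)%nat) (seq 1 (n / 8)).

(* j_1 < j_2 < ..., stored at positions 0, 1, ... *)
Definition jlist (n : nat) : list nat :=
  filter (fun j => negb (existsb (Nat.eqb j) (skipped n))) (seq 1 (n / 2 - 1)).

Fixpoint p (n : nat) (t : R) (i : nat) : point :=
  match i with
  | O => (0, 0)
  | S i' => add_signed (p n t i') i' (u t (nth i' (jlist n) 0%nat))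
  end.

Definition q (n : nat) (t : R) (k : nat) : point :=
  add_signed (p n t (3 * k - 2)) k (u t (4 * k - 2)).

Definition rho (z : point) : point := (- fst z, snd z).

Definition A_equation (n : nat) (t : R) : Prop :=
  dist (p n t (3 * n / 8 - 2)) (rho (p n t (3 * n / 8 - 1))) = 2 * sin (t / 2).

Definition A_is_angle (n : nat) (t : R) : Prop :=
  (0 < t < PI / INR n /\ A_equation n t) /\
  forall t' : R, 0 < t' < PI / INR n -> A_equation n t' -> t' <= t.

Definition A_half (n : nat) (t : R) : list point :=
  map (p n t) (seq 1 (3 * n / 8 - 1)) ++ map (q n t) (seq 1 (n / 8)).

Definition A_points (n : nat) (t : R) : list point :=
  (0, 0) :: (0, 1) :: A_half n t ++ map rho (A_half n t).

(* epsilon is used as a definite description: the largest solution is unique,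
   and a convex polygon is determined by its vertex set up to the choice of the
   vertex at which the counterclockwise listing starts. *)
Definition A_angle (n : nat) : R := epsilon (inhabits 0) (A_is_angle n).

Definition A (n : nat) : polygon :=
  epsilon (inhabits nil)
    (fun P => convex P /\
              forall z : point, In z P <-> In z (A_points n (A_angle n))).

(* Main.v *)
Require Import Defs.
From Stdlib Require Import Reals List.
From Stdlib Require Import Lra Lia ZArith Arith Bool ClassicalEpsilon Machin.
Import ListNotations.
Open Scope R_scope.

(** The perimeter of A_32 is about 3.1402461, while the general upper bound for
    the perimeter of a convex small 32-gon is 64 sin (PI / 64), about
    3.1403312.  The proof separates A_32 from a better polygon by the number
    3.14026.

    The better polygon.  Dividing by its diameter makes any convex equilateral
    polygon small, so it suffices to find a convex equilateral 32-gon whose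
    perimeter exceeds 3.14026 times its diameter.  A polygon close to optimal
    has one edge along each of the 32 directions (2 k + 1) PI / 64 modulo PI.
    Among the choices of the senses of these edges that are symmetric about an
    axis, some make the sum of the edges almost zero, closer to zero than the
    choice underlying A_32.  A small change of the angles then closes the
    polygon, and can be made so that all edges are integer vectors of one and
    the same length.  The resulting polygon has integer vertices, its perimeter
    is about 3.1402773 times its diameter, and all its properties are checked
    by integer computation (witness_convex, witness_equilateral, witness_small,
    witness_perimeter).

    The bound for A_32.  The equation for the angle t is equivalent to the
    vanishing of a trigonometric polynomial, called gap below.  It changes sign
    between t_lo and t_hi, two numbers less than PI / 32 and 10^-10 apart, and
    it is strictly decreasing on [t_lo, t_up] with t_up > PI / 32.  Hence it has
    a largest zero in (0, PI / 32), and this zero lies in [t_lo, t_hi]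
    (A_angle_bounds).  For every t in that interval, interval arithmetic
    encloses the points of A_32 tightly enough to show that, listed in a
    suitable order, they form a convex polygon with sides at most 3.14026 / 32.
    A convex polygon is determined by its vertex set up to a rotation of the
    list (convex_next_vertex), so that the bound passes to the polygon that the
    definition of A selects (A_32_perimeter). *)

(** * Convex polygons and their vertex sets *)

Lemma vertex_in (P : polygon) (i : nat) :
  (0 < length P)%nat -> In (vertex P i) P.
Proof.
  intros h. unfold vertex. apply nth_In. apply Nat.mod_upper_bound. lia.
Qed.

Lemma in_vertex (P : polygon) (z : point) :
  In z P -> exists i, (i < length P)%nat /\ vertex P i = z.
Proof.
  intros h. destruct (In_nth P z (0, 0) h) as [i [hi e]].
  exists i. split; auto. unfold vertex. now rewrite Nat.mod_small.
Qed.

Lemma vertex_mod (P : polygon) (i : nat) :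
  (0 < length P)%nat -> vertex P (i mod length P) = vertex P i.
Proof.
  intros h. unfold vertex. rewrite Nat.Div0.mod_mod. reflexivity.
Qed.

Lemma cross_swap (a b c : point) : cross a b c = - cross a c b.
Proof. unfold cross. ring. Qed.

Lemma cross_refl (a b : point) : cross a b a = 0.
Proof. unfold cross. ring. Qed.

Lemma convex_vertex_inj (P : polygon) (i k : nat) :
  convex P -> (i < length P)%nat -> (k < length P)%nat ->
  vertex P i = vertex P k -> i = k.
Proof.
  intros [h3 hc] hi hk e.
  destruct (Nat.eq_dec k i) as [|n1]; [auto|exfalso].
  destruct (Nat.eq_dec k (S i mod length P)) as [e1|n2].
  - (* k follows i, and the side from i to k is a point, which has no left. *)
    assert (exists m, (m < length P)%nat /\ m <> i /\ m <> k) as [m [hm [m1 m2]]].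
    { destruct (Nat.eq_dec i 0); destruct (Nat.eq_dec k 0);
      destruct (Nat.eq_dec i 1); destruct (Nat.eq_dec k 1);
      solve [exists 0%nat; lia | exists 1%nat; lia | exists 2%nat; lia]. }
    assert (h := hc i m hi hm m1 ltac:(lia)).
    rewrite <- (vertex_mod P (S i)), <- e1, <- e in h by lia.
    unfold cross in h. lra.
  - assert (h := hc i k hi hk n1 n2). rewrite <- e, cross_refl in h. lra.
Qed.

Lemma convex_NoDup (P : polygon) : convex P -> NoDup P.
Proof.
  intros hc. apply (NoDup_nth P (0, 0)). intros i j hi hj e.
  apply (convex_vertex_inj P i j hc hi hj).
  unfold vertex. rewrite !Nat.mod_small; auto.
Qed.

(** In a convex polygon, the successor of a vertex z is the only vertex w such
    that all vertices other than z and w lie strictly to the left of the line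
    from z to w; hence the vertex set determines it. *)
Lemma convex_next_vertex (P Q : polygon) (i j : nat) :
  convex P -> convex Q -> (forall z, In z P <-> In z Q) ->
  (i < length P)%nat -> (j < length Q)%nat ->
  vertex P i = vertex Q j -> vertex P (S i) = vertex Q (S j).
Proof.
  intros cP cQ hPQ hi hj e.
  destruct (cP) as [lP hP]; destruct (cQ) as [lQ hQ].
  assert (iP : In (vertex P (S i)) Q) by (apply hPQ, vertex_in; lia).
  assert (iQ : In (vertex Q (S j)) P) by (apply hPQ, vertex_in; lia).
  destruct (in_vertex _ _ iP) as [k [hk ek]].
  destruct (in_vertex _ _ iQ) as [l [hl el]].
  assert (next : forall R m, convex R -> (m < length R)%nat ->
            vertex R (S m) <> vertex R m).
  { intros R m cR hm eq. assert (cR' := cR). destruct cR' as [lR _].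
    rewrite <- (vertex_mod R (S m)) in eq by lia.
    apply convex_vertex_inj in eq; auto; [|apply Nat.mod_upper_bound; lia].
    destruct (Nat.eq_dec (S m) (length R)) as [e'|n'].
    - rewrite e', Nat.Div0.mod_same in eq. lia.
    - rewrite Nat.mod_small in eq; lia. }
  destruct (Nat.eq_dec k (S j mod length Q)) as [ek'|nk].
  { rewrite <- ek, ek'. apply vertex_mod; lia. }
  destruct (Nat.eq_dec l (S i mod length P)) as [el'|nl].
  { rewrite <- el, el'. symmetry. apply vertex_mod; lia. }
  assert (kj : k <> j).
  { intros ->. apply (next P i cP hi). congruence. }
  assert (li : l <> i).
  { intros ->. apply (next Q j cQ hj). congruence. }
  assert (h1 := hQ j k hj hk kj nk). assert (h2 := hP i l hi hl li nl).
  (* Each of the two successors would lie strictly to the left of the line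
     from the common vertex to the other one. *)
  rewrite ek in h1. rewrite el, e, cross_swap in h2. lra.
Qed.

Lemma fold_sum_le (f : nat -> R) (s : R) (l : list nat) :
  (forall i, In i l -> f i <= s) ->
  fold_right Rplus 0 (map f l) <= INR (length l) * s.
Proof.
  induction l as [|a l IH]; intros h.
  - simpl. lra.
  - assert (h1 := h a (or_introl eq_refl)).
    assert (h2 := IH (fun i hi => h i (or_intror hi))).
    cbn [length map fold_right]. rewrite S_INR. lra.
Qed.

Lemma fold_sum_const (f : nat -> R) (s : R) (l : list nat) :
  (forall i, In i l -> f i = s) ->
  fold_right Rplus 0 (map f l) = INR (length l) * s.
Proof.
  induction l as [|a l IH]; intros h.
  - simpl. lra.
  - assert (h1 := h a (or_introl eq_refl)).
    assert (h2 := IH (fun i hi => h i (or_intror hi))).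
    cbn [length map fold_right]. rewrite S_INR. lra.
Qed.

(** Two convex polygons with the same vertex set have the same sides, so a
    bound on the sides of one bounds the perimeter of the other. *)
Lemma perimeter_same_vertices_le (P Q : polygon) (s : R) :
  convex P -> convex Q -> (forall z, In z P <-> In z Q) ->
  (forall j, (j < length Q)%nat -> side Q j <= s) ->
  perimeter P <= INR (length Q) * s.
Proof.
  intros cP cQ hPQ hs.
  assert (len : length P = length Q).
  { apply Nat.le_antisymm; apply NoDup_incl_length; auto using convex_NoDup;
    intros z; apply hPQ. }
  rewrite <- len. rewrite <- (length_seq (length P) 0) at 1.
  apply fold_sum_le. intros i hi. apply in_seq in hi.
  assert (lP := proj1 cP).
  assert (iQ : In (vertex P i) Q) by (apply hPQ, vertex_in; lia).
  destruct (in_vertex _ _ iQ) as [j [hj ej]].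
  unfold side.
  rewrite (convex_next_vertex P Q i j cP cQ hPQ) by (auto; lia).
  rewrite <- ej. apply hs, hj.
Qed.

(** * A better polygon *)

(** The edges of the right half of the integer polygon, from its lowest vertex
    (0, 0) to its highest vertex.  They have the common length [edge_length], a
    product of nine primes congruent to 1 modulo 4, so that many integer
    vectors of that length exist; their abscissas sum to 0, so that the
    reflection in the vertical axis closes the polygon. *)
Definition half_edges : list (Z * Z) :=
  [(11348734590167, 1683565571844);
   (10372504334260, 4902991298025);
   (9840131206191, 5899151437088);
   (8502007630740, 7703508037225);
   (6834884620704, 9214799078353);
   (4903789097760, 10372127183825);
   (3864332976975, 10802550646760);
   (2788944830100, 11128789537385);
   (-564322572948, 11459044893289);
   (-1682618974608, 11348874975919);
   (-5899151437088, 9840131206191);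
   (-7705754994775, 8499971164260);
   (-9214198266793, 6835694561124);
   (-10801596890700, 3866998117865);
   (-11128544350385, 2789923023000);
   (-11459141799600, 562351357615)]%Z.

Definition edge_length : Z := 11472932050385%Z.

(** The points reached from z by adding the vectors of es one after another. *)
Fixpoint walk (z : Z * Z) (es : list (Z * Z)) : list (Z * Z) :=
  match es with
  | nil => [z]
  | e :: es' => z :: walk (fst z + fst e, snd z + snd e)%Z es'
  end.

(** The vertices of the right half, then the reflections of those not on the
    axis, from top to bottom: a counterclockwise listing. *)
Definition witnessZ : list (Z * Z) :=
  let right := walk (0, 0)%Z half_edges in
  right ++ map (fun z => (- fst z, snd z)%Z) (rev (removelast (tl right))).

(** Integer counterparts of [cross], of the squared distance and of
    [vertex]. *)
Definition crossZ (a b c : Z * Z) : Z :=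
  ((fst b - fst a) * (snd c - snd a) - (snd b - snd a) * (fst c - fst a))%Z.

Definition dist2Z (a b : Z * Z) : Z :=
  ((fst a - fst b) ^ 2 + (snd a - snd b) ^ 2)%Z.

Definition vertexZ (L : list (Z * Z)) (i : nat) : Z * Z :=
  nth (i mod length L) L (0, 0)%Z.

(** The square of the diameter of [witnessZ]. *)
Definition diam2 : Z := 13668246302463599422664092093%Z.

(** The test f i k succeeds for all the pairs of indices that the definition of
    convexity of an n-gon involves. *)
Definition strictly_leftb (n : nat) (f : nat -> nat -> bool) : bool :=
  forallb (fun i => forallb (fun k =>
    (k =? i)%nat || (k =? S i mod n)%nat || f i k) (seq 0 n)) (seq 0 n).

Lemma strictly_leftb_spec (n : nat) (f : nat -> nat -> bool) :
  strictly_leftb n f = true ->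
  forall i k, (i < n)%nat -> (k < n)%nat -> k <> i -> k <> (S i mod n)%nat ->
  f i k = true.
Proof.
  intros h i k hi hk n1 n2. unfold strictly_leftb in h.
  rewrite forallb_forall in h. specialize (h i).
  rewrite in_seq, forallb_forall in h. specialize (h ltac:(lia) k).
  rewrite in_seq in h. specialize (h ltac:(lia)).
  rewrite !orb_true_iff, !Nat.eqb_eq in h. tauto.
Qed.

Lemma witnessZ_convex : strictly_leftb 32 (fun i k =>
  (0 <? crossZ (vertexZ witnessZ i) (vertexZ witnessZ (S i))
               (vertexZ witnessZ k))%Z) = true.
Proof. vm_compute. reflexivity. Qed.

Lemma witnessZ_sides : forallb (fun i =>
  (dist2Z (vertexZ witnessZ i) (vertexZ witnessZ (S i)) =? edge_length ^ 2)%Z)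
  (seq 0 32) = true.
Proof. vm_compute. reflexivity. Qed.

Lemma witnessZ_diam_le : forallb (fun a => forallb (fun b =>
  (dist2Z a b <=? diam2)%Z) witnessZ) witnessZ = true.
Proof. vm_compute. reflexivity. Qed.

Lemma witnessZ_diam_attained : existsb (fun a => existsb (fun b =>
  (dist2Z a b =? diam2)%Z) witnessZ) witnessZ = true.
Proof. vm_compute. reflexivity. Qed.

(** Division by the diameter, which makes the polygon small. *)
Definition shrink (z : Z * Z) : point :=
  (IZR (fst z) / sqrt (IZR diam2), IZR (snd z) / sqrt (IZR diam2)).

Definition witness : polygon := map shrink witnessZ.

Lemma diam_pos : 0 < sqrt (IZR diam2).
Proof. apply sqrt_lt_R0. apply IZR_lt. reflexivity. Qed.

Lemma length_witness : length witness = 32%nat.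
Proof. reflexivity. Qed.

Lemma vertex_witness (i : nat) : vertex witness i = shrink (vertexZ witnessZ i).
Proof.
  unfold vertex, vertexZ, witness. rewrite length_map.
  rewrite <- (map_nth shrink). f_equal.
  unfold shrink. cbn [fst snd]. unfold Rdiv. rewrite Rmult_0_l. reflexivity.
Qed.

Lemma cross_shrink (a b c : Z * Z) :
  cross (shrink a) (shrink b) (shrink c)
  = IZR (crossZ a b c) / (sqrt (IZR diam2) * sqrt (IZR diam2)).
Proof.
  assert (h := diam_pos).
  unfold cross, crossZ, shrink. cbn [fst snd].
  rewrite !minus_IZR, !mult_IZR, !minus_IZR. field. lra.
Qed.

Lemma dist_shrink (a b : Z * Z) :
  Defs.dist (shrink a) (shrink b) = sqrt (IZR (dist2Z a b)) / sqrt (IZR diam2).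
Proof.
  assert (h := diam_pos).
  unfold Defs.dist, dist_euc, dist2Z, shrink. cbn [fst snd].
  rewrite plus_IZR, <- !(pow_IZR _ 2), !minus_IZR.
  rewrite <- sqrt_div_alt by (apply IZR_lt; reflexivity).
  f_equal. rewrite <- (sqrt_sqrt (IZR diam2)) at 5 by (apply IZR_le; discriminate).
  unfold Rsqr. simpl. field. lra.
Qed.

Lemma witness_convex : convex witness.
Proof.
  split; [rewrite length_witness; lia|].
  rewrite length_witness. intros i k hi hk n1 n2.
  assert (h := strictly_leftb_spec _ _ witnessZ_convex i k hi hk n1 n2).
  apply Z.ltb_lt, IZR_lt in h.
  rewrite !vertex_witness, cross_shrink. assert (d := diam_pos).
  apply Rdiv_lt_0_compat; [exact h|nra].
Qed.

Lemma witness_side (i : nat) : (i < 32)%nat ->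
  side witness i = IZR edge_length / sqrt (IZR diam2).
Proof.
  intros hi. unfold side. rewrite !vertex_witness, dist_shrink.
  assert (h := witnessZ_sides). rewrite forallb_forall in h.
  specialize (h i). rewrite in_seq in h. specialize (h ltac:(lia)).
  apply Z.eqb_eq in h. rewrite h. f_equal.
  rewrite <- (pow_IZR _ 2). apply sqrt_pow2. apply IZR_le. discriminate.
Qed.

Lemma witness_equilateral : equilateral witness.
Proof.
  intros i j. rewrite length_witness. intros hi hj.
  rewrite !witness_side; auto.
Qed.

Lemma witness_small : small witness.
Proof.
  assert (hd := diam_pos). split.
  - assert (h := witnessZ_diam_attained).
    apply existsb_exists in h. destruct h as [a [ha h]].
    apply existsb_exists in h. destruct h as [b [hb h]].
    apply Z.eqb_eq in h.
    exists (shrink a), (shrink b). repeat split; try (now apply in_map).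
    rewrite dist_shrink, h. field. lra.
  - intros z w hz hw.
    apply in_map_iff in hz. destruct hz as [a [<- ha]].
    apply in_map_iff in hw. destruct hw as [b [<- hb]].
    assert (h := witnessZ_diam_le). rewrite forallb_forall in h.
    specialize (h a ha). rewrite forallb_forall in h. specialize (h b hb).
    apply Z.leb_le, IZR_le in h. rewrite dist_shrink.
    apply (Rmult_le_reg_r (sqrt (IZR diam2))); [exact hd|].
    unfold Rdiv. rewrite Rmult_assoc, Rinv_l, Rmult_1_r, Rmult_1_l by lra.
    apply sqrt_le_1_alt, h.
Qed.

Lemma witness_perimeter : 3.14026 < perimeter witness.
Proof.
  unfold perimeter. rewrite length_witness.
  rewrite (fold_sum_const _ (IZR edge_length / sqrt (IZR diam2))).
  2:{ intros i hi. apply in_seq in hi. apply witness_side. lia. }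
  rewrite length_seq. assert (hd := diam_pos).
  assert (h : sqrt (IZR diam2) < 32 * IZR edge_length / 3.14026).
  { rewrite <- (sqrt_pow2 (32 * IZR edge_length / 3.14026)) by (unfold edge_length; lra).
    apply sqrt_lt_1_alt. unfold diam2, edge_length. lra. }
  apply (Rmult_lt_reg_r (sqrt (IZR diam2))); [exact hd|].
  replace (INR 32) with 32 by (simpl; lra).
  unfold Rdiv. rewrite Rmult_assoc, Rmult_assoc, Rinv_l by lra. lra.
Qed.

(** * Rigorous fixed-point arithmetic *)

Definition scale : Z := (2 ^ 60)%Z.

(** A ball (m, r) encloses the reals at distance at most r / [scale] from
    m / [scale]. *)
Definition ball : Type := (Z * Z)%type.

Definition near (x : R) (b : ball) : Prop :=
  Rabs (x * IZR scale - IZR (fst b)) <= IZR (snd b).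

(** Operations on balls that respect [near]. *)
Definition add_ball (a b : ball) : ball := (fst a + fst b, snd a + snd b)%Z.
Definition opp_ball (a : ball) : ball := (- fst a, snd a)%Z.
Definition sub_ball (a b : ball) : ball := add_ball a (opp_ball b).
Definition int_ball (k : Z) : ball := (k * scale, 0)%Z.

(* The two units added to the radius absorb the rounding of the two shifts. *)
Definition mul_ball (a b : ball) : ball :=
  (Z.shiftr (fst a * fst b) 60,
   Z.shiftr (Z.abs (fst a) * snd b + Z.abs (fst b) * snd a + snd a * snd b) 60
   + 2)%Z.

Lemma scale_pos : 0 < IZR scale.
Proof. apply IZR_lt. reflexivity. Qed.

Lemma near_add (x y : R) (a b : ball) :
  near x a -> near y b -> near (x + y) (add_ball a b).
Proof.
  unfold near, add_ball. cbn [fst snd]. intros hx hy.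
  rewrite !plus_IZR.
  replace ((x + y) * IZR scale - (IZR (fst a) + IZR (fst b))) with
    ((x * IZR scale - IZR (fst a)) + (y * IZR scale - IZR (fst b))) by ring.
  eapply Rle_trans; [apply Rabs_triang|]. lra.
Qed.

Lemma near_opp (x : R) (a : ball) : near x a -> near (- x) (opp_ball a).
Proof.
  unfold near, opp_ball. cbn [fst snd]. intros hx.
  rewrite opp_IZR.
  replace (- x * IZR scale - - IZR (fst a)) with
    (- (x * IZR scale - IZR (fst a))) by ring.
  now rewrite Rabs_Ropp.
Qed.

Lemma near_sub (x y : R) (a b : ball) :
  near x a -> near y b -> near (x - y) (sub_ball a b).
Proof. intros hx hy. apply near_add; [exact hx|apply near_opp, hy]. Qed.

Lemma near_int (k : Z) : near (IZR k) (int_ball k).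
Proof.
  unfold near, int_ball. cbn [fst snd].
  rewrite mult_IZR, Rminus_diag, Rabs_R0. lra.
Qed.

Lemma IZR_shiftr_bounds (k : Z) :
  IZR (Z.shiftr k 60) * IZR scale <= IZR k
  < (IZR (Z.shiftr k 60) + 1) * IZR scale.
Proof.
  rewrite Z.shiftr_div_pow2 by discriminate. fold scale.
  assert (e := Z.div_mod k scale ltac:(discriminate)).
  assert (b := Z.mod_pos_bound k scale ltac:(reflexivity)).
  rewrite <- plus_IZR, <- !mult_IZR. split; [apply IZR_le|apply IZR_lt]; lia.
Qed.

Lemma near_mul (x y : R) (a b : ball) :
  near x a -> near y b -> near (x * y) (mul_ball a b).
Proof.
  unfold near, mul_ball. cbn [fst snd]. intros hx hy.
  destruct a as [m r], b as [n s]. cbn [fst snd] in *.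
  assert (hS := scale_pos).
  set (S := IZR scale) in *.
  assert (k := IZR_shiftr_bounds (m * n)).
  assert (e := IZR_shiftr_bounds (Z.abs m * s + Z.abs n * r + r * s)).
  fold S in k, e.
  rewrite !plus_IZR, !mult_IZR, !abs_IZR in e. rewrite mult_IZR in k.
  rewrite plus_IZR.
  set (K := IZR (Z.shiftr (m * n) 60)) in *.
  set (E := IZR (Z.shiftr (_ + _ + _) 60)) in *.
  set (dx := x * S - IZR m) in *. set (dy := y * S - IZR n) in *.
  assert (H : Rabs (x * S * (y * S) - IZR m * IZR n)
              <= Rabs (IZR m) * IZR s + Rabs (IZR n) * IZR r + IZR r * IZR s).
  { replace (x * S * (y * S) - IZR m * IZR n) with
      (IZR m * dy + IZR n * dx + dx * dy) by (unfold dx, dy; ring).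
    eapply Rle_trans; [apply Rabs_triang|].
    eapply Rle_trans; [apply Rplus_le_compat_r, Rabs_triang|].
    rewrite !Rabs_mult.
    assert (p1 := Rabs_pos (IZR m)). assert (p2 := Rabs_pos (IZR n)).
    assert (p3 := Rabs_pos dx). assert (p4 := Rabs_pos dy).
    apply Rplus_le_compat; [apply Rplus_le_compat|];
      apply Rmult_le_compat; lra. }
  apply (Rmult_le_reg_r S); [exact hS|].
  rewrite <- (Rabs_pos_eq S) at 2 by lra. rewrite <- Rabs_mult.
  replace ((x * y * S - K) * S) with
    ((x * S * (y * S) - IZR m * IZR n) + (IZR m * IZR n - K * S)) by ring.
  eapply Rle_trans; [apply Rabs_triang|].
  assert (Rabs (IZR m * IZR n - K * S) <= S) by (apply Rabs_le; lra).
  lra.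
Qed.

Lemma near_lower (x : R) (b : ball) (k : Z) :
  near x b -> (k < fst b - snd b)%Z -> IZR k < x * IZR scale.
Proof.
  intros h hk. apply IZR_lt in hk. rewrite minus_IZR in hk.
  unfold near in h. assert (h1 := Rle_abs (x * IZR scale - IZR (fst b)));
  assert (h2 := Rle_abs (- (x * IZR scale - IZR (fst b))));
  rewrite Rabs_Ropp in h2; lra.
Qed.

Lemma near_upper (x : R) (b : ball) (k : Z) :
  near x b -> (fst b + snd b < k)%Z -> x * IZR scale < IZR k.
Proof.
  intros h hk. apply IZR_lt in hk. rewrite plus_IZR in hk.
  unfold near in h. assert (h1 := Rle_abs (x * IZR scale - IZR (fst b)));
  assert (h2 := Rle_abs (- (x * IZR scale - IZR (fst b))));
  rewrite Rabs_Ropp in h2; lra.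
Qed.

Lemma near_pos (x : R) (b : ball) :
  near x b -> (0 < fst b - snd b)%Z -> 0 < x.
Proof.
  intros h hk. apply (near_lower x b 0 h) in hk. assert (s := scale_pos). nra.
Qed.

Lemma near_neg (x : R) (b : ball) :
  near x b -> (fst b + snd b < 0)%Z -> x < 0.
Proof.
  intros h hk. apply (near_upper x b 0 h) in hk. assert (s := scale_pos). nra.
Qed.

Definition near_point (z : point) (b : ball * ball) : Prop :=
  near (fst z) (fst b) /\ near (snd z) (snd b).

Lemma near_point_origin : near_point (0, 0) (int_ball 0, int_ball 0).
Proof. split; apply near_int. Qed.

Lemma Forall2_nth {X Y : Type} (Rel : X -> Y -> Prop) (l : list X) (m : list Y)
  (d : X) (e : Y) (k : nat) :
  Forall2 Rel l m -> Rel d e -> Rel (nth k l d) (nth k m e).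
Proof.
  intros h hd. revert k. induction h; intros [|k]; simpl; auto.
Qed.

Lemma Forall2_map_seq {X Y : Type} (Rel : X -> Y -> Prop)
  (f : nat -> X) (g : nat -> Y) (l : list nat) :
  (forall i, Rel (f i) (g i)) -> Forall2 Rel (map f l) (map g l).
Proof. intros h. induction l; simpl; constructor; auto. Qed.

Definition cross_ball (a b c : ball * ball) : ball :=
  sub_ball
    (mul_ball (sub_ball (fst b) (fst a)) (sub_ball (snd c) (snd a)))
    (mul_ball (sub_ball (snd b) (snd a)) (sub_ball (fst c) (fst a))).

Lemma near_cross (a b c : point) (a' b' c' : ball * ball) :
  near_point a a' -> near_point b b' -> near_point c c' ->
  near (cross a b c) (cross_ball a' b' c').
Proof.
  intros [ha1 ha2] [hb1 hb2] [hc1 hc2].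
  apply near_sub; apply near_mul; apply near_sub; assumption.
Qed.

Definition dist2_ball (a b : ball * ball) : ball :=
  let dx := sub_ball (fst a) (fst b) in
  let dy := sub_ball (snd a) (snd b) in
  add_ball (mul_ball dx dx) (mul_ball dy dy).

Definition dist2 (a b : point) : R :=
  Rsqr (fst a - fst b) + Rsqr (snd a - snd b).

Lemma near_dist2 (a b : point) (a' b' : ball * ball) :
  near_point a a' -> near_point b b' -> near (dist2 a b) (dist2_ball a' b').
Proof.
  intros [ha1 ha2] [hb1 hb2].
  apply near_add; apply near_mul; apply near_sub; assumption.
Qed.

Definition vertex_ball (L : list (ball * ball)) (i : nat) : ball * ball :=
  nth (i mod length L) L (int_ball 0, int_ball 0).

Lemma near_vertex (P : polygon) (L : list (ball * ball)) (i : nat) :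
  Forall2 near_point P L -> near_point (vertex P i) (vertex_ball L i).
Proof.
  intros h. unfold vertex, vertex_ball. rewrite (Forall2_length h).
  apply Forall2_nth; [exact h|apply near_point_origin].
Qed.

(** * Enclosures of the trigonometric functions *)

Lemma INR_fact_S (n : nat) : INR (fact (S n)) = INR (S n) * INR (fact n).
Proof. rewrite fact_simpl. apply mult_INR. Qed.

Ltac expand_taylor :=
  unfold sin_approx, cos_approx, sin_term, cos_term;
  cbn [sum_f_R0 Nat.mul Nat.add];
  rewrite ?INR_fact_S; change (INR (fact 0)) with 1;
  rewrite ?S_INR; change (INR 0) with 0; field.

Lemma sin_approx_3 (x : R) :
  sin_approx x 3 = x - x ^ 3 / 6 + x ^ 5 / 120 - x ^ 7 / 5040.
Proof. expand_taylor. Qed.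

Lemma sin_approx_4 (x : R) : sin_approx x 4 =
  x - x ^ 3 / 6 + x ^ 5 / 120 - x ^ 7 / 5040 + x ^ 9 / 362880.
Proof. expand_taylor. Qed.

Lemma cos_approx_3 (x : R) :
  cos_approx x 3 = 1 - x ^ 2 / 2 + x ^ 4 / 24 - x ^ 6 / 720.
Proof. expand_taylor. Qed.

Lemma cos_approx_4 (x : R) : cos_approx x 4 =
  1 - x ^ 2 / 2 + x ^ 4 / 24 - x ^ 6 / 720 + x ^ 8 / 40320.
Proof. expand_taylor. Qed.

Lemma sin_enclosure (a b t : R) : 0 <= a -> a <= t <= b -> b <= 1 ->
  a - a ^ 3 / 6 + a ^ 5 / 120 - a ^ 7 / 5040 <= sin t
  <= b - b ^ 3 / 6 + b ^ 5 / 120 - b ^ 7 / 5040 + b ^ 9 / 362880.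
Proof.
  intros h0 [h1 h2] h3. assert (hPI := PI2_1).
  split.
  - apply Rle_trans with (sin a).
    + rewrite <- sin_approx_3.
      exact (proj1 (sin_bound a 1 ltac:(lra) ltac:(lra))).
    + apply sin_incr_1; lra.
  - apply Rle_trans with (sin b).
    + apply sin_incr_1; lra.
    + rewrite <- sin_approx_4.
      exact (proj2 (sin_bound b 1 ltac:(lra) ltac:(lra))).
Qed.

Lemma cos_enclosure (a b t : R) : 0 <= a -> a <= t <= b -> b <= 1 ->
  1 - b ^ 2 / 2 + b ^ 4 / 24 - b ^ 6 / 720 <= cos t
  <= 1 - a ^ 2 / 2 + a ^ 4 / 24 - a ^ 6 / 720 + a ^ 8 / 40320.
Proof.
  intros h0 [h1 h2] h3. assert (hPI := PI2_1).
  split.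
  - apply Rle_trans with (cos b).
    + rewrite <- cos_approx_3.
      exact (proj1 (cos_bound b 1 ltac:(lra) ltac:(lra))).
    + apply cos_decr_1; lra.
  - apply Rle_trans with (cos a).
    + apply cos_decr_1; lra.
    + rewrite <- cos_approx_4.
      exact (proj2 (cos_bound a 1 ltac:(lra) ltac:(lra))).
Qed.

(** B is a pair of balls enclosing sin t and cos t. *)
Definition near_trig (t : R) (B : ball * ball) : Prop :=
  near_point (sin t, cos t) B.

(** The angle of A_32 is about 0.098172109009 and PI / 32 about 0.0981747704:
    t_lo and t_hi enclose the former, t_up exceeds the latter. *)
Definition t_lo : R := 9817210895 / 100000000000.
Definition t_hi : R := 9817210905 / 100000000000.
Definition t_up : R := 98175 / 1000000.

(** Enclosures of sine and cosine at t_lo, at t_hi, on [t_lo, t_hi] and on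
    [t_lo, t_up].  The smallest radii, 10^6, leave room for the truncation
    of the Taylor polynomials. *)
Definition trig_lo : ball * ball :=
  ((113003015209751961, 1000000), (1147370173195390521, 1000000))%Z.
Definition trig_hi : ball * ball :=
  ((113003015324488978, 1000000), (1147370173184090219, 1000000))%Z.
Definition trig_mid : ball * ball :=
  ((113003015267120469, 58425877), (1147370173189740370, 6655800))%Z.
Definition trig_wide : ball * ball :=
  ((113004673761785442, 1660211585514), (1147370009844309481, 163515432120))%Z.

Lemma near_trig_from_bounds (a b t : R) (B : ball * ball) :
  0 <= a -> a <= t <= b -> b <= 1 ->
  IZR (fst (fst B) - snd (fst B))
    <= (a - a ^ 3 / 6 + a ^ 5 / 120 - a ^ 7 / 5040) * IZR scale ->
  (b - b ^ 3 / 6 + b ^ 5 / 120 - b ^ 7 / 5040 + b ^ 9 / 362880) * IZR scale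
    <= IZR (fst (fst B) + snd (fst B)) ->
  IZR (fst (snd B) - snd (snd B))
    <= (1 - b ^ 2 / 2 + b ^ 4 / 24 - b ^ 6 / 720) * IZR scale ->
  (1 - a ^ 2 / 2 + a ^ 4 / 24 - a ^ 6 / 720 + a ^ 8 / 40320) * IZR scale
    <= IZR (fst (snd B) + snd (snd B)) ->
  near_trig t B.
Proof.
  intros h0 h1 h2 s1 s2 c1 c2.
  assert (hs := sin_enclosure a b t h0 h1 h2).
  assert (hc := cos_enclosure a b t h0 h1 h2).
  assert (hS := scale_pos).
  rewrite minus_IZR in s1, c1. rewrite plus_IZR in s2, c2.
  split; unfold near; cbn [fst snd]; apply Rabs_le.
  - assert (e1 := Rmult_le_compat_r _ _ _ (Rlt_le _ _ hS) (proj1 hs)).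
    assert (e2 := Rmult_le_compat_r _ _ _ (Rlt_le _ _ hS) (proj2 hs)). lra.
  - assert (e1 := Rmult_le_compat_r _ _ _ (Rlt_le _ _ hS) (proj1 hc)).
    assert (e2 := Rmult_le_compat_r _ _ _ (Rlt_le _ _ hS) (proj2 hc)). lra.
Qed.

Lemma near_trig_lo : near_trig t_lo trig_lo.
Proof.
  apply (near_trig_from_bounds t_lo t_lo); unfold t_lo, trig_lo, scale;
    cbn [fst snd]; simpl Z.sub; simpl Z.add; simpl Z.pow; lra.
Qed.

Lemma near_trig_hi : near_trig t_hi trig_hi.
Proof.
  apply (near_trig_from_bounds t_hi t_hi); unfold t_hi, trig_hi, scale;
    cbn [fst snd]; simpl Z.sub; simpl Z.add; simpl Z.pow; lra.
Qed.

Lemma near_trig_mid (t : R) : t_lo <= t <= t_hi -> near_trig t trig_mid.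
Proof.
  intros h. apply (near_trig_from_bounds t_lo t_hi); try exact h;
    unfold t_lo, t_hi, trig_mid, scale;
    cbn [fst snd]; simpl Z.sub; simpl Z.add; simpl Z.pow; lra.
Qed.

Lemma near_trig_wide (t : R) : t_lo <= t <= t_up -> near_trig t trig_wide.
Proof.
  intros h. apply (near_trig_from_bounds t_lo t_up); try exact h;
    unfold t_lo, t_up, trig_wide, scale;
    cbn [fst snd]; simpl Z.sub; simpl Z.add; simpl Z.pow; lra.
Qed.

(** From partial sums of the series for PI / 4 = 2 atan (1/3) + atan (1/7). *)
Lemma PI_enclosure : 32 * t_hi < PI < 32 * t_up.
Proof.
  assert (h := PI_2_3_7_ineq 4). destruct h as [h1 h2].
  unfold PI_2_3_7_tg, tg_alt, Ratan_seq in h1, h2. simpl in h1, h2.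
  unfold t_hi, t_up. lra.
Qed.

(** * Enclosures of the vertices of A_n *)

(** Encloses u t j when B encloses (sin t, cos t). *)
Fixpoint u_ball (B : ball * ball) (j : nat) : ball * ball :=
  match j with
  | O => (int_ball 0, int_ball 1)
  | S j' =>
      let b := u_ball B j' in
      (add_ball (mul_ball (fst b) (snd B)) (mul_ball (snd b) (fst B)),
       sub_ball (mul_ball (snd b) (snd B)) (mul_ball (fst b) (fst B)))
  end.

Lemma near_u (t : R) (B : ball * ball) (j : nat) :
  near_trig t B -> near_point (u t j) (u_ball B j).
Proof.
  intros [hs hc]. unfold u. induction j as [|j [IHs IHc]].
  - simpl INR. rewrite Rmult_0_l, sin_0, cos_0.
    split; [apply (near_int 0)|apply (near_int 1)].
  - rewrite S_INR, Rmult_plus_distr_r, Rmult_1_l, sin_plus, cos_plus.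
    split; cbn [u_ball fst snd];
      [apply near_add|apply near_sub]; apply near_mul; assumption.
Qed.

Definition add_signed_ball (a : ball * ball) (e : nat) (b : ball * ball) :
  ball * ball :=
  if Nat.even e then (add_ball (fst a) (fst b), add_ball (snd a) (snd b))
  else (sub_ball (fst a) (fst b), sub_ball (snd a) (snd b)).

Lemma pow_minus_one (e : nat) : (-1) ^ e = if Nat.even e then 1 else -1.
Proof.
  induction e as [|e IH]; [reflexivity|].
  rewrite Nat.even_succ, <- Nat.negb_even. simpl pow. rewrite IH.
  destruct (Nat.even e); simpl; ring.
Qed.

Lemma near_add_signed (a b : point) (e : nat) (a' b' : ball * ball) :
  near_point a a' -> near_point b b' ->
  near_point (add_signed a e b) (add_signed_ball a' e b').
Proof.
  intros [h1 h2] [k1 k2]. unfold add_signed, add_signed_ball.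
  rewrite pow_minus_one. destruct (Nat.even e); split; cbn [fst snd].
  1, 2: rewrite Rmult_1_l; apply near_add; assumption.
  - replace (fst a + -1 * fst b) with (fst a - fst b) by ring.
    apply near_sub; assumption.
  - replace (snd a + -1 * snd b) with (snd a - snd b) by ring.
    apply near_sub; assumption.
Qed.

(** Ball counterparts of p, q, rho, [A_half] and [A_points]. *)
Fixpoint p_ball (n : nat) (B : ball * ball) (i : nat) : ball * ball :=
  match i with
  | O => (int_ball 0, int_ball 0)
  | S i' => add_signed_ball (p_ball n B i') i'
              (u_ball B (nth i' (jlist n) 0%nat))
  end.

Definition q_ball (n : nat) (B : ball * ball) (k : nat) : ball * ball :=
  add_signed_ball (p_ball n B (3 * k - 2)) k (u_ball B (4 * k - 2)).

Definition rho_ball (b : ball * ball) : ball * ball :=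
  (opp_ball (fst b), snd b).

Lemma near_p (n : nat) (t : R) (B : ball * ball) (i : nat) :
  near_trig t B -> near_point (p n t i) (p_ball n B i).
Proof.
  intros h. induction i as [|i IH]; [apply near_point_origin|].
  apply near_add_signed; [exact IH|apply near_u, h].
Qed.

Lemma near_q (n : nat) (t : R) (B : ball * ball) (k : nat) :
  near_trig t B -> near_point (q n t k) (q_ball n B k).
Proof.
  intros h. apply near_add_signed; [apply near_p, h|apply near_u, h].
Qed.

Lemma near_rho (z : point) (b : ball * ball) :
  near_point z b -> near_point (rho z) (rho_ball b).
Proof. intros [h1 h2]. split; [apply near_opp, h1|exact h2]. Qed.

Definition A_half_ball (n : nat) (B : ball * ball) : list (ball * ball) :=
  map (p_ball n B) (seq 1 (3 * n / 8 - 1)) ++ map (q_ball n B) (seq 1 (n / 8)).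

Definition A_points_ball (n : nat) (B : ball * ball) : list (ball * ball) :=
  (int_ball 0, int_ball 0) :: (int_ball 0, int_ball 1) ::
  A_half_ball n B ++ map rho_ball (A_half_ball n B).

Lemma near_A_points (n : nat) (t : R) (B : ball * ball) :
  near_trig t B -> Forall2 near_point (A_points n t) (A_points_ball n B).
Proof.
  intros h.
  assert (half : Forall2 near_point (A_half n t) (A_half_ball n B)).
  { apply Forall2_app; apply Forall2_map_seq; intros i;
      [apply near_p, h|apply near_q, h]. }
  constructor; [apply near_point_origin|].
  constructor; [split; apply near_int|].
  apply Forall2_app; [exact half|].
  induction half; simpl; constructor; auto using near_rho.
Qed.

(** * The angle of A_32 *)

(** The difference of the squares of the two sides of the equation
    |p_i - rho (p_k)| = 2 sin (t / 2); the angle of A_n is defined by the case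
    i = 3 n / 8 - 2 and k = 3 n / 8 - 1. *)
Definition gap (n i k : nat) (t : R) : R :=
  dist2 (p n t i) (rho (p n t k)) - (2 - 2 * cos t).

Lemma A_equation_gap (t : R) : 0 < t < PI ->
  (A_equation 32 t <-> gap 32 10 11 t = 0).
Proof.
  intros ht. unfold A_equation.
  change (3 * 32 / 8 - 2)%nat with 10%nat.
  change (3 * 32 / 8 - 1)%nat with 11%nat.
  unfold gap, Defs.dist, dist_euc. fold (dist2 (p 32 t 10) (rho (p 32 t 11))).
  set (d := dist2 _ _).
  assert (hd : 0 <= d) by (apply Rplus_le_le_0_compat; apply Rle_0_sqr).
  assert (hs : 0 < sin (t / 2)) by (apply sin_gt_0; lra).
  assert (e : 2 - 2 * cos t = (2 * sin (t / 2)) * (2 * sin (t / 2))).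
  { replace t with (2 * (t / 2)) at 1 by field. rewrite cos_2a_sin. ring. }
  split; intros h.
  - rewrite <- (sqrt_sqrt d hd), h, e. ring.
  - assert (h' : d = (2 * sin (t / 2)) * (2 * sin (t / 2))) by lra.
    rewrite h'. apply sqrt_square. lra.
Qed.

(** Derivatives of u and p with respect to t. *)
Definition du (t : R) (j : nat) : point :=
  (INR j * cos (INR j * t), - (INR j * sin (INR j * t))).

Fixpoint dp (n : nat) (t : R) (i : nat) : point :=
  match i with
  | O => (0, 0)
  | S i' => add_signed (dp n t i') i' (du t (nth i' (jlist n) 0%nat))
  end.

(** l is the derivative at t of the plane curve f. *)
Definition has_derivative (f : R -> point) (t : R) (l : point) : Prop :=
  derivable_pt_lim (fun s => fst (f s)) t (fst l) /\
  derivable_pt_lim (fun s => snd (f s)) t (snd l).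

Lemma derivable_pt_lim_linear (c t : R) : derivable_pt_lim (fun s => c * s) t c.
Proof.
  assert (h := derivable_pt_lim_scal id c t 1 (derivable_pt_lim_id t)).
  rewrite Rmult_1_r in h. exact h.
Qed.

Lemma u_has_derivative (t : R) (j : nat) :
  has_derivative (fun s => u s j) t (du t j).
Proof.
  split; unfold u, du; cbn [fst snd].
  - rewrite Rmult_comm.
    apply (derivable_pt_lim_comp (fun s => INR j * s) sin).
    + apply derivable_pt_lim_linear.
    + apply derivable_pt_lim_sin.
  - replace (- (INR j * sin (INR j * t))) with (- sin (INR j * t) * INR j) by ring.
    apply (derivable_pt_lim_comp (fun s => INR j * s) cos).
    + apply derivable_pt_lim_linear.
    + apply derivable_pt_lim_cos.
Qed.

Lemma p_has_derivative (n : nat) (t : R) (i : nat) :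
  has_derivative (fun s => p n s i) t (dp n t i).
Proof.
  induction i as [|i [IH1 IH2]].
  - split; apply derivable_pt_lim_const.
  - destruct (u_has_derivative t (nth i (jlist n) 0%nat)) as [h1 h2].
    split; cbn [p dp add_signed fst snd].
    + apply (derivable_pt_lim_plus (fun s => fst (p n s i))); [exact IH1|].
      apply (derivable_pt_lim_scal
               (fun s => fst (u s (nth i (jlist n) 0%nat)))); exact h1.
    + apply (derivable_pt_lim_plus (fun s => snd (p n s i))); [exact IH2|].
      apply (derivable_pt_lim_scal
               (fun s => snd (u s (nth i (jlist n) 0%nat)))); exact h2.
Qed.

(** The derivative of [gap]. *)
Definition dgap (n i k : nat) (t : R) : R :=
  2 * ((fst (p n t i) + fst (p n t k)) * (fst (dp n t i) + fst (dp n t k))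
       + (snd (p n t i) - snd (p n t k)) * (snd (dp n t i) - snd (dp n t k))
       - sin t).

Lemma gap_derivable (n i k : nat) (t : R) :
  derivable_pt_lim (gap n i k) t (dgap n i k t).
Proof.
  destruct (p_has_derivative n t i) as [a1 a2].
  destruct (p_has_derivative n t k) as [b1 b2].
  assert (s1 := derivable_pt_lim_plus _ _ _ _ _ a1 b1).
  assert (s2 := derivable_pt_lim_minus _ _ _ _ _ a2 b2).
  assert (q1 := derivable_pt_lim_mult _ _ _ _ _ s1 s1).
  assert (q2 := derivable_pt_lim_mult _ _ _ _ _ s2 s2).
  assert (c := derivable_pt_lim_minus _ _ _ _ _
                 (derivable_pt_lim_const 2 t)
                 (derivable_pt_lim_scal _ 2 _ _ (derivable_pt_lim_cos t))).
  assert (h := derivable_pt_lim_minus _ _ _ _ _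
                 (derivable_pt_lim_plus _ _ _ _ _ q1 q2) c).
  match type of h with derivable_pt_lim _ _ ?l =>
    replace l with (dgap n i k t) in h end.
  - refine (derivable_pt_lim_ext _ _ _ _ _ h). intros s.
    unfold gap, dist2, rho, Rsqr, plus_fct, minus_fct, mult_fct, fct_cte,
      mult_real_fct. cbn [fst snd]. ring.
  - unfold dgap, plus_fct, minus_fct. ring.
Qed.

Definition du_ball (B : ball * ball) (j : nat) : ball * ball :=
  let b := u_ball B j in
  let j' := int_ball (Z.of_nat j) in
  (mul_ball j' (snd b), opp_ball (mul_ball j' (fst b))).

Fixpoint dp_ball (n : nat) (B : ball * ball) (i : nat) : ball * ball :=
  match i with
  | O => (int_ball 0, int_ball 0)
  | S i' => add_signed_ball (dp_ball n B i') i'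
              (du_ball B (nth i' (jlist n) 0%nat))
  end.

Lemma near_dp (n : nat) (t : R) (B : ball * ball) (i : nat) :
  near_trig t B -> near_point (dp n t i) (dp_ball n B i).
Proof.
  intros h. induction i as [|i IH]; [apply near_point_origin|].
  apply near_add_signed; [exact IH|].
  set (j := nth i (jlist n) 0%nat). destruct (near_u t B j h) as [h1 h2].
  unfold du, du_ball. rewrite INR_IZR_INZ at 1 3.
  split; cbn [fst snd]; [|apply near_opp];
    apply near_mul; try apply near_int; assumption.
Qed.

Definition gap_ball (n i k : nat) (B : ball * ball) : ball :=
  sub_ball (dist2_ball (p_ball n B i) (rho_ball (p_ball n B k)))
           (sub_ball (int_ball 2) (mul_ball (int_ball 2) (snd B))).

Lemma near_gap (n i k : nat) (t : R) (B : ball * ball) :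
  near_trig t B -> near (gap n i k t) (gap_ball n i k B).
Proof.
  intros h. apply near_sub.
  - apply near_dist2; [|apply near_rho]; apply near_p, h.
  - apply near_sub; [apply near_int|].
    apply near_mul; [apply near_int|apply h].
Qed.

Definition dgap_ball (n i k : nat) (B : ball * ball) : ball :=
  let a := p_ball n B i in let b := p_ball n B k in
  let a' := dp_ball n B i in let b' := dp_ball n B k in
  mul_ball (int_ball 2) (sub_ball
    (add_ball (mul_ball (add_ball (fst a) (fst b)) (add_ball (fst a') (fst b')))
              (mul_ball (sub_ball (snd a) (snd b)) (sub_ball (snd a') (snd b'))))
    (fst B)).

Lemma near_dgap (n i k : nat) (t : R) (B : ball * ball) :
  near_trig t B -> near (dgap n i k t) (dgap_ball n i k B).
Proof.
  intros h. destruct (near_p n t B i h). destruct (near_p n t B k h).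
  destruct (near_dp n t B i h). destruct (near_dp n t B k h).
  apply near_mul; [apply near_int|].
  apply near_sub; [|apply h].
  apply near_add; apply near_mul;
    first [apply near_add; assumption|apply near_sub; assumption].
Qed.

Lemma gap_lo_pos : 0 < gap 32 10 11 t_lo.
Proof.
  apply (near_pos _ _ (near_gap 32 10 11 _ _ near_trig_lo)).
  vm_compute. reflexivity.
Qed.

Lemma gap_hi_neg : gap 32 10 11 t_hi < 0.
Proof.
  apply (near_neg _ _ (near_gap 32 10 11 _ _ near_trig_hi)).
  vm_compute. reflexivity.
Qed.

(** By the mean value theorem; the interval reaches beyond PI / 32, so that no
    solution between t_hi and PI / 32 is missed. *)
Lemma gap_decreasing (s t : R) :
  t_lo <= s -> s < t -> t <= t_up -> gap 32 10 11 t < gap 32 10 11 s.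
Proof.
  intros h1 h2 h3.
  destruct (MVT_cor2 (gap 32 10 11) (dgap 32 10 11) s t h2) as [c [e hc]].
  { intros c _. apply gap_derivable. }
  assert (hn : dgap 32 10 11 c < 0).
  { apply (near_neg _ (dgap_ball 32 10 11 trig_wide)).
    - apply near_dgap, near_trig_wide. lra.
    - vm_compute. reflexivity. }
  nra.
Qed.

Lemma gap_continuous : continuity (gap 32 10 11).
Proof.
  intros t. apply derivable_continuous_pt.
  exists (dgap 32 10 11 t). apply gap_derivable.
Qed.

Lemma A_angle_exists : exists t, A_is_angle 32 t.
Proof.
  assert (hPI := PI_enclosure).
  assert (hlo := gap_lo_pos). assert (hhi := gap_hi_neg).
  destruct (IVT (fun t => - gap 32 10 11 t) t_lo t_hi) as [t [ht e]].
  - apply (continuity_opp _ gap_continuous).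
  - unfold t_lo, t_hi. lra.
  - lra.
  - lra.
  - assert (b : 0 < t_lo) by (unfold t_lo; lra).
    exists t. unfold A_is_angle.
    replace (INR 32) with 32 by (simpl; lra).
    split; [split; [lra|]|].
    + apply A_equation_gap; lra.
    + intros t' ht' e'. apply A_equation_gap in e'; [|lra].
      apply Rnot_lt_le. intros lt.
      assert (d := gap_decreasing t t' ltac:(lra) lt ltac:(lra)). lra.
Qed.

Lemma A_angle_bounds : t_lo <= A_angle 32 <= t_hi.
Proof.
  assert (h := epsilon_spec (inhabits 0) (A_is_angle 32) A_angle_exists).
  fold (A_angle 32) in h. set (a := A_angle 32) in *.
  destruct h as [[ha ea] hmax].
  replace (INR 32) with 32 in * by (simpl; lra).
  assert (hPI := PI_enclosure).
  assert (hlo := gap_lo_pos). assert (hhi := gap_hi_neg).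
  assert (b : 0 < t_lo) by (unfold t_lo; lra).
  destruct (IVT (fun t => - gap 32 10 11 t) t_lo t_hi) as [t [ht e]];
    try lra.
  - apply (continuity_opp _ gap_continuous).
  - unfold t_lo, t_hi. lra.
  - assert (le : t <= a) by (apply hmax; [lra|apply A_equation_gap; lra]).
    split; [lra|]. apply Rnot_lt_le. intros lt.
    assert (d := gap_decreasing t_hi a ltac:(lra) lt ltac:(lra)).
    apply A_equation_gap in ea; lra.
Qed.

(** * The perimeter of A_32 *)

(** Positions in [A_points 32 t] of the vertices, in counterclockwise order. *)
Definition A_order : list nat :=
  [0; 28; 18; 20; 22; 30; 24; 26; 12; 16; 10; 8; 6; 14; 4; 2;
   1; 17; 19; 29; 21; 23; 25; 31; 27; 11; 9; 15; 7; 5; 3; 13]%nat.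

Definition A_listing (t : R) : polygon :=
  map (fun k => nth k (A_points 32 t) (0, 0)) A_order.

Definition A_listing_ball (B : ball * ball) : list (ball * ball) :=
  let L := A_points_ball 32 B in
  map (fun k => nth k L (int_ball 0, int_ball 0)) A_order.

Lemma length_A_listing (t : R) : length (A_listing t) = 32%nat.
Proof. reflexivity. Qed.

Lemma length_A_points (t : R) : length (A_points 32 t) = 32%nat.
Proof. reflexivity. Qed.

Lemma near_A_listing (t : R) (B : ball * ball) :
  near_trig t B -> Forall2 near_point (A_listing t) (A_listing_ball B).
Proof.
  intros h. apply Forall2_map_seq. intros k.
  apply Forall2_nth; [apply near_A_points, h|apply near_point_origin].
Qed.

Lemma A_order_spec (k : nat) : In k A_order <-> (k < 32)%nat.
Proof.
  split.
  - assert (h : forallb (fun k => k <? 32)%nat A_order = true) by reflexivity.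
    rewrite forallb_forall in h. intros hk. apply Nat.ltb_lt, h, hk.
  - assert (h : forallb (fun k => existsb (Nat.eqb k) A_order) (seq 0 32) = true)
      by reflexivity.
    rewrite forallb_forall in h. intros hk.
    specialize (h k). rewrite in_seq, existsb_exists in h.
    destruct (h ltac:(lia)) as [k' [hk' e]]. apply Nat.eqb_eq in e. now subst.
Qed.

Lemma in_A_listing (t : R) (z : point) :
  In z (A_listing t) <-> In z (A_points 32 t).
Proof.
  unfold A_listing. rewrite in_map_iff. split.
  - intros [k [<- hk]]. apply nth_In. rewrite length_A_points.
    apply A_order_spec, hk.
  - intros hz. destruct (In_nth _ _ (0, 0) hz) as [k [hk e]].
    exists k. split; [exact e|]. apply A_order_spec.
    now rewrite <- (length_A_points t).
Qed.

Lemma A_listing_ball_convex :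
  let L := A_listing_ball trig_mid in
  strictly_leftb 32 (fun i k =>
    let c := cross_ball (vertex_ball L i) (vertex_ball L (S i)) (vertex_ball L k)
    in (0 <? fst c - snd c)%Z) = true.
Proof. vm_compute. reflexivity. Qed.

(** The square of 3.14026 / 32, rounded down to a multiple of 1 / [scale]. *)
Definition side2_bound : Z := 11102761166984261%Z.

Lemma A_listing_ball_sides :
  let L := A_listing_ball trig_mid in
  forallb (fun i =>
    let d := dist2_ball (vertex_ball L i) (vertex_ball L (S i))
    in (fst d + snd d <? side2_bound)%Z) (seq 0 32) = true.
Proof. vm_compute. reflexivity. Qed.

Lemma A_listing_convex (t : R) : t_lo <= t <= t_hi -> convex (A_listing t).
Proof.
  intros ht. assert (h := near_A_listing t _ (near_trig_mid t ht)).
  split; [rewrite length_A_listing; lia|].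
  rewrite length_A_listing. intros i k hi hk n1 n2.
  eapply near_pos; [apply near_cross; apply (near_vertex _ _ _ h)|].
  apply Z.ltb_lt.
  exact (strictly_leftb_spec _ _ A_listing_ball_convex i k hi hk n1 n2).
Qed.

Lemma A_listing_side (t : R) (i : nat) :
  t_lo <= t <= t_hi -> (i < 32)%nat -> side (A_listing t) i <= 3.14026 / 32.
Proof.
  intros ht hi. assert (h := near_A_listing t _ (near_trig_mid t ht)).
  unfold side, Defs.dist, dist_euc.
  fold (dist2 (vertex (A_listing t) i) (vertex (A_listing t) (S i))).
  rewrite <- (sqrt_pow2 (3.14026 / 32)) by lra. apply sqrt_le_1_alt.
  assert (b := A_listing_ball_sides). cbv zeta in b.
  rewrite forallb_forall in b. specialize (b i). rewrite in_seq in b.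
  specialize (b ltac:(lia)). apply Z.ltb_lt in b.
  eapply near_upper in b;
    [|apply near_dist2; apply (near_vertex _ _ _ h)].
  apply Rlt_le, (Rmult_lt_reg_r (IZR scale)); [apply scale_pos|].
  eapply Rlt_le_trans; [exact b|].
  unfold scale, side2_bound. simpl Z.pow. lra.
Qed.

Lemma A_32_perimeter : perimeter (A 32) <= 3.14026.
Proof.
  assert (ha := A_angle_bounds). set (a := A_angle 32) in *.
  assert (hA : convex (A 32) /\
               forall z, In z (A 32) <-> In z (A_points 32 (A_angle 32))).
  { apply (epsilon_spec (inhabits nil) (fun P : polygon => convex P /\
             forall z : point, In z P <-> In z (A_points 32 (A_angle 32)))).
    exists (A_listing a). split; [apply A_listing_convex, ha|].
    intros z. apply in_A_listing. }
  destruct hA as [cA iA].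
  replace 3.14026 with (INR (length (A_listing a)) * (3.14026 / 32))
    by (rewrite length_A_listing; simpl; lra).
  apply (perimeter_same_vertices_le _ _ _ cA (A_listing_convex a ha)).
  - intros z. rewrite iA. symmetry. apply in_A_listing.
  - intros j hj. apply A_listing_side; [exact ha|exact hj].
Qed.

Theorem proposition1 :
  exists P : polygon,
    length P = 32%nat /\ convex P /\ equilateral P /\ small P /\
    perimeter (A 32) < perimeter P.
Proof.
  exists witness. split; [exact length_witness|].
  split; [exact witness_convex|]. split; [exact witness_equilateral|].
  split; [exact witness_small|].
  eapply Rle_lt_trans; [exact A_32_perimeter|exact witness_perimeter].
Qed.
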